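(* Let $n\in\mathbb N$, and let $F,P\subset\mathrm{GL}_n(\mathbb R)$ be the sets defined in the context. Then: (1) $F\cdot p\cap F\cdot q=\emptyset$ for every $p\neq q$ in $P$; (2) $\bigcup_{p\in P}F\cdot p=\mathrm{GL}_n(\mathbb R)$.
   Context: $\mathrm O_n$ is the group of real orthogonal $n\times n$ matrices. For a set $S$ of matrices and a matrix $p$, $S\cdot p=\{sp:s\in S\}$. $F$ is the set of all matrices of the form $s\,k\,z$ where $s\in[1,2)$, $k\in\mathrm O_n$, and $z$ is the upper triangular matrix with entries $z_{i,i}=w_i$ for $1\le i\le n$, $z_{i,j}=w_iy_{i,j}$ for $i<j$, and $z_{i,j}=0$ for $i>j$, with $w_1,\dots,w_{n-1}\in[1,2)$, $w_n=\prod_{i=1}^{n-1}w_i^{-1}$, and $y_{i,j}\in[0,1)$ for $1\le i<j\le n$. $P$ is the set of all matrices of the form $2^{\lambda}q$ where $\lambda\in\mathbb Z$ and $q$ is the upper triangular matrix with entries $q_{i,i}=2^{\kappa_i}$ for $1\le i\le n$, $q_{i,j}=2^{\kappa_j}\mu_{i,j}$ for $i<j$, and $q_{i,j}=0$ for $i>j$, with $\kappa_1,\dots,\kappa_{n-1}\in\mathbb Z$, $\kappa_n=-\sum_{i=1}^{n-1}\kappa_i$, and $\mu_{i,j}\in\mathbb Z$ for $1\le i<j\le n$. *)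

(* Defs.v *)
From mathcomp Require Import all_boot all_order all_algebra.
From mathcomp Require Import classical_sets reals.
Set Implicit Arguments.
Unset Strict Implicit.
Unset Printing Implicit Defensive.
Import Order.TTheory GRing.Theory Num.Theory.
Local Open Scope classical_set_scope.
Local Open Scope ring_scope.

(* Indices are 0-based: the mathematical index i in 1..n is (i - 1 : 'I_n), so
   the last index is the i : 'I_n with i.+1 = n, and i < n.-1 says that i is
   not the last index. *)

Definition GLset (R : realType) (n : nat) : set 'M[R]_n :=
  [set A | A \in unitmx].

Definition orthogonal_group (R : realType) (n : nat) : set 'M[R]_n :=
  [set k | k^T *m k = 1%:M].

Definition right_translate (R : realType) (n : nat)
    (S : set 'M[R]_n) (p : 'M[R]_n) : set 'M[R]_n :=
  [set s *m p | s in S].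

(* Only the values y i j with i < j are used. *)
Definition zmatrix (R : realType) (n : nat)
    (w : 'I_n -> R) (y : 'I_n -> 'I_n -> R) : 'M[R]_n :=
  \matrix_(i, j) if i == j then w i
                 else if (i < j)%N then w i * y i j else 0.

(* Only the values mu i j with i < j are used. *)
Definition qmatrix (R : realType) (n : nat)
    (kappa : 'I_n -> int) (mu : 'I_n -> 'I_n -> int) : 'M[R]_n :=
  \matrix_(i, j) if i == j then 2 ^ kappa i
                 else if (i < j)%N then 2 ^ kappa j * (mu i j)%:~R else 0.

Definition Fset (R : realType) (n : nat) : set 'M[R]_n :=
  [set A | exists (s : R) (k : 'M[R]_n) (w : 'I_n -> R) (y : 'I_n -> 'I_n -> R),
    [/\ 1 <= s < 2,
        @orthogonal_group R n k,
        [/\ forall i : 'I_n, (i < n.-1)%N -> 1 <= w i < 2,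
            forall i : 'I_n, i.+1 = n ->
              w i = \prod_(j < n | (j < n.-1)%N) (w j)^-1 &
            forall i j : 'I_n, (i < j)%N -> 0 <= y i j < 1] &
        A = s *: (k *m zmatrix w y)]].

Definition Pset (R : realType) (n : nat) : set 'M[R]_n :=
  [set A | exists (lambda : int) (kappa : 'I_n -> int)
                  (mu : 'I_n -> 'I_n -> int),
    (forall i : 'I_n, i.+1 = n ->
       kappa i = - \sum_(j < n | (j < n.-1)%N) kappa j) /\
    A = (2 ^ lambda) *: qmatrix R kappa mu].

Arguments GLset : clear implicits.
Arguments orthogonal_group : clear implicits.
Arguments Fset : clear implicits.
Arguments Pset : clear implicits.

(* Main.v *)
Require Import Defs.
From mathcomp Require Import all_boot all_order all_algebra.
From mathcomp Require Import ring lra zify.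
From mathcomp Require Import boolp classical_sets reals.
Import Order.TTheory GRing.Theory Num.Theory.
Local Open Scope classical_set_scope.
Local Open Scope ring_scope.

(** Let [Y] and [N] be the upper triangular matrices with unit diagonal and
    off-diagonal entries [y i j] and [mu i j].  Then [z = diag(w) Y] and
    [q = N diag(2^kappa)], so the elements of [F p] with [p = 2^lambda q] are
    the products [A = k T] with
    [T = (s 2^lambda) diag(w) (Y N) diag(2^kappa)] ([FP_productE]).  Such a
    product is invertible.  Conversely, for [n > 0], every invertible [A] is
    of this form, and [p] is determined by [A], because each layer of the
    product is a factorization that exists and is unique:

    - [k] is orthogonal and [T] is upper triangular with positive diagonal, so
      this is the QR decomposition of [A]; it exists ([QR_exists]) and
      determines [T] ([QR_upper_inj]), since [T] is the Cholesky factor of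
      [A^T A].

    - The diagonal of [T] is [r (w i) 2^(kappa i)] with [r = s 2^lambda].  The
      conditions on the last [w] and the last [kappa] say that the [w i], and
      likewise the [2^(kappa i)], have product 1 ([last_factor]), so [r] must be
      the positive [n]-th root of the product of the diagonal of [T].  Then
      [s], [lambda], the [w i] and the [kappa i] are read off from the fact
      that a positive real is in exactly one way a number in [1, 2) times a
      power of 2 ([normalized_exists], [normalized_inj]).

    - Dividing the diagonal matrices out of [T] leaves a unitriangular matrix.
      Each of these is in exactly one way a product [Y N] with [Y] having
      off-diagonal entries in [0, 1) and [N] having integer ones: the
      interval is a fundamental domain for the integers acting on the reals,
      and this propagates through the triangular shape, one row at a time
      ([unitriangular_factor], [unitriangular_factor_inj]). *)

(** * Triangular matrices *)

(** One predicate covers all the triangular shapes in use: [D] constrains the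
    diagonal and [P] the entries above it, so that a single block
    decomposition serves every induction on the size. *)
Definition upper_triangular {R : nzRingType} (D P : pred R)
    {n : nat} (A : 'M[R]_n) :=
  forall i j : 'I_n,
    if (j < i)%N then A i j = 0 else if i == j then D (A i j) else P (A i j).

Lemma upper_triangular_block {R : nzRingType} (D P : pred R) n
    (a : 'M[R]_1) (u : 'rV[R]_n) (B : 'M[R]_n) :
  D (a 0 0) -> (forall j, P (u 0 j)) -> upper_triangular D P B ->
  upper_triangular D P (block_mx a u 0 B : 'M_(1 + n)).
Proof.
move=> Da Pu PB i j.
case: (split_ordP i) => i' ->; case: (split_ordP j) => j' ->.
- by rewrite block_mxEul !ord1 ltnn eqxx; exact: Da.
- by rewrite block_mxEur /= eq_lrshift !ord1 /=; exact: Pu.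
- by rewrite block_mxEdl !ord1 mxE.
- by rewrite block_mxEdr /= ltn_add2l eq_rshift; exact: PB.
Qed.

Lemma upper_triangular_blockP {R : nzRingType} {D P : pred R} {n}
    {A : 'M[R]_(1 + n)} :
  upper_triangular D P A ->
  exists (a : 'M[R]_1) (u : 'rV[R]_n) (B : 'M[R]_n),
    [/\ A = block_mx a u 0 B, D (a 0 0), forall j, P (u 0 j) &
        upper_triangular D P B].
Proof.
move=> TA; exists (ulsubmx A), (ursubmx A), (drsubmx A).
have dl0 : dlsubmx A = 0.
  apply/matrixP => i j; rewrite !mxE.
  by have := TA (rshift 1 i) (lshift n j); rewrite /= ord1.
split.
- by rewrite -dl0 submxK.
- by have := TA (lshift n 0) (lshift n 0); rewrite !mxE eqxx.
- move=> j; have := TA (lshift n 0) (rshift 1 j).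
  by rewrite eq_lrshift !mxE.
- move=> i j; have := TA (rshift 1 i) (rshift 1 j).
  by rewrite /= ltn_add2l eq_rshift !mxE.
Qed.

Lemma det_upper_triangular {R : comNzRingType} {D P : pred R} {n}
    {A : 'M[R]_n} :
  upper_triangular D P A -> \det A = \prod_i A i i.
Proof.
move=> TA; rewrite -det_tr det_trig; last first.
  by apply/is_trig_mxP => i j lij; rewrite mxE; have := TA j i; rewrite lij.
by apply: eq_bigr => i _; rewrite mxE.
Qed.

Lemma upper_triangular_diag {R : nzRingType} {D P : pred R} {n} {A : 'M[R]_n} :
  upper_triangular D P A -> forall i, D (A i i).
Proof. by move=> TA i; have := TA i i; rewrite ltnn eqxx. Qed.

(** * Unitriangular matrices as fractional times integral *)

Definition fractional {R : numDomainType} : pred R := fun x => 0 <= x < 1.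
Definition integral {R : archiNumDomainType} : pred R :=
  fun x => x \is a Num.int.

(** The reason for uniqueness: the first nonzero entry of [d] would be an entry
    of [d *m N], since [N] has unit diagonal, hence a nonzero integer of
    absolute value less than 1. *)
Lemma int_row_small {R : archiRealDomainType} n (d : 'rV[R]_n) (N : 'M[R]_n) :
  upper_triangular (pred1 1) integral N ->
  (forall j, `|d 0 j| < 1) -> (forall j, (d *m N) 0 j \is a Num.int) -> d = 0.
Proof.
move=> TN d1 dN; apply/rowP => j; rewrite [RHS]mxE.
have [k] := ubnP (j : nat); elim: k j => // k IH j ltjk.
have := dN j; rewrite mxE (bigD1 j) //=.
rewrite (eqP (upper_triangular_diag TN j)) mulr1 big1 => [|l lj]; last first.
  case: (ltngtP l j) => [ltlj|ltjl|/val_inj/eqP]; last by rewrite (negPf lj).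
    by rewrite IH ?mul0r // (leq_trans ltlj).
  by have := TN l j; rewrite ltjl => ->; rewrite mulr0.
rewrite addr0 => dint; apply/eqP; apply: contraTT (d1 j) => dn0.
by rewrite -leNgt norm_intr_ge1.
Qed.

(** Peeling off the first row, the equation between the remaining entries of
    that row reads [(y - y') N0 = m' - m], where the left factor has entries in
    the open interval (-1, 1) and the right-hand side is integral. *)
Lemma unitriangular_factor_inj {R : archiRealDomainType} n
    (Y Y' N N' : 'M[R]_n) :
  upper_triangular (pred1 1) fractional Y ->
  upper_triangular (pred1 1) fractional Y' ->
  upper_triangular (pred1 1) integral N ->
  upper_triangular (pred1 1) integral N' ->
  Y *m N = Y' *m N' -> N = N'.
Proof.
elim: n => [|n IH] in Y Y' N N' *; first by move=> *; apply/matrixP => -[].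
move: Y Y' N N'; rewrite -[n.+1]/(1 + n)%N => Y Y' N N'.
move=> /upper_triangular_blockP[a [y [Y0 [-> /eqP a1 Hy TY]]]].
move=> /upper_triangular_blockP[a' [y' [Y0' [-> /eqP a'1 Hy' TY']]]].
move=> /upper_triangular_blockP[b [m [N0 [-> /eqP b1 Hm TN]]]].
move=> /upper_triangular_blockP[b' [m' [N0' [-> /eqP b'1 Hm' TN']]]].
have E (c : 'M[R]_1) : c 0 0 = 1 -> c = 1%:M.
  by move=> c1; rewrite [c]mx11_scalar c1.
rewrite (E a) // (E a') // (E b) // (E b') //.
rewrite !mulmx_block !(mul0mx, mulmx0, mul1mx, mulmx1, addr0, add0r).
move=> /eq_block_mx[_ eqr _ eqB].
have eqN := IH _ _ _ _ TY TY' TN TN' eqB; rewrite -eqN in eqr *.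
suff d0 : y - y' = 0.
  by move: eqr; rewrite (subr0_eq d0) => /addIr ->.
apply: (int_row_small _ _ _ TN) => j.
  rewrite !mxE; move: (Hy j) (Hy' j); rewrite /fractional ltr_norml; lra.
have -> : (y - y') *m N0 = m' - m.
  by apply/eqP; rewrite mulmxBl subr_eq addrAC -eqr addrC addKr.
by rewrite !mxE; apply: rpredB; [exact: Hm' | exact: Hm].
Qed.

(** Given [U0 = Y N] for the lower right block, the first row [u] has to be
    written [m + y N]; with [v = u N^-1], take [y] to be the fractional part of
    [v] and [m = floor(v) N], which is integral because [N] is. *)
Lemma unitriangular_factor {R : archiRealDomainType} n (U : 'M[R]_n) :
  upper_triangular (pred1 1) predT U ->
  exists Y N : 'M[R]_n,
    [/\ upper_triangular (pred1 1) fractional Y,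
        upper_triangular (pred1 1) integral N & U = Y *m N].
Proof.
elim: n => [|n IH] in U *.
  by exists 1%:M, 1%:M; split; try (by case); apply/matrixP => -[].
move: U; rewrite -[n.+1]/(1 + n)%N => U.
move=> /upper_triangular_blockP[a [u [U0 [-> /eqP a1 _ TU]]]].
have [Y [N [TY TN eqU]]] := IH _ TU.
have Nu : N \in unitmx.
  rewrite unitmxE (det_upper_triangular TN) big1 ?unitr1 // => i _.
  exact/eqP/(upper_triangular_diag TN).
have [v vN] : exists v, v *m N = u by exists (u *m invmx N); rewrite mulmxKV.
pose f : 'rV[R]_n := \row_j (Num.floor (v 0 j))%:~R.
exists (block_mx 1%:M (v - f) 0 Y), (block_mx 1%:M (f *m N) 0 N); split.
- apply: upper_triangular_block => // [|j]; first by rewrite mxE /=.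
  rewrite !mxE /fractional subr_ge0 floor_le ltrBlDl.
  by have /andP[_] := floor_itv (v 0 j); rewrite intrD addrC.
- apply: upper_triangular_block => // [|j]; first by rewrite mxE /=.
  rewrite mxE; apply: rpred_sum => l _; rewrite mxE; apply: rpredM => //.
    exact: intr_int.
  have := TN l j; case: ifP => _; first by move->; exact: rpred0.
  by case: eqP => // _ /eqP ->; exact: rpred1.
- rewrite mulmx_block !(mul0mx, mulmx0, mul1mx, mulmx1, addr0, add0r) -eqU.
  by rewrite mulmxBl vN addrC subrK [a]mx11_scalar a1.
Qed.

(** * Cholesky and QR decompositions *)

(** Completing the square on the first coordinate is the congruence [eqM],
    which reduces [M] to the identity on that coordinate and to the Schur
    complement [C] on the others; [C] is again positive definite, as a
    congruence preserves the quadratic form. *)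
Lemma cholesky {R : rcfType} n (M : 'M[R]_n) :
  M^T = M -> (forall v : 'cV[R]_n, v != 0 -> 0 < (v^T *m M *m v) 0 0) ->
  exists2 T : 'M[R]_n, upper_triangular (> 0) predT T & T^T *m T = M.
Proof.
elim: n => [|n IH] in M *.
  by exists 1%:M; [case | apply/matrixP => -[]].
move: M; rewrite -[n.+1]/(1 + n)%N => M symM posM.
have al_gt0 : 0 < M 0 0.
  have := posM (delta_mx 0 0); rewrite trmx_delta -rowE -colE !mxE; apply.
  apply/eqP => /matrixP/(_ 0 0); rewrite !mxE !eqxx => /eqP.
  by rewrite oner_eq0.
pose s := Num.sqrt (M 0 0).
have s_gt0 : 0 < s by rewrite sqrtr_gt0.
have s_neq0 : s != 0 by rewrite gt_eqF.
pose u := s^-1 *: ursubmx M.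
pose C := drsubmx M - u^T *m u.
have eqM : M = (block_mx s%:M u 0 1%:M)^T *m block_mx 1%:M 0 0 C
                 *m block_mx s%:M u 0 1%:M.
  rewrite tr_block_mx !mulmx_block.
  rewrite !(trmx0, trmx1, mul0mx, mulmx0, mul1mx, mulmx1, addr0, add0r).
  rewrite tr_scalar_mx !mul_scalar_mx mul_mx_scalar scale_scalar_mx.
  rewrite -expr2 sqr_sqrtr ?ltW // addrC subrK -[LHS]submxK.
  have su : s *: u = ursubmx M by rewrite scalerA mulfV // scale1r.
  congr block_mx; last by rewrite -linearZ /= su trmx_ursub symM.
    by rewrite [LHS]mx11_scalar !mxE lshift0.
  by rewrite su.
have symC : C^T = C.
  by rewrite /C linearB /= trmx_mul trmxK trmx_drsub symM.
have posC (w : 'cV[R]_n) : w != 0 -> 0 < (w^T *m C *m w) 0 0.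
  (* [v] is the preimage of [(0, w)] under the triangular change of basis. *)
  move=> w0; pose v := col_mx (- s^-1 *: (u *m w)) w.
  have Ev : block_mx s%:M u 0 1%:M *m v = col_mx 0 w.
    rewrite mul_block_col !mul_scalar_mx scale1r scalerA mulrN mulfV //.
    by rewrite scaleN1r addNr mul0mx add0r.
  have := posM v; rewrite eqM !mulmxA -trmx_mul Ev -mulmxA Ev tr_col_mx.
  rewrite mul_row_block mul_row_col !(mulmx0, add0r); apply.
  apply: contra_neq w0 => v0.
  by move: Ev; rewrite v0 mulmx0 -[0 in LHS]col_mx0 => /eq_col_mx[].
have [T TT eqC] := IH C symC posC.
exists (block_mx s%:M u 0 T).
  by apply: upper_triangular_block; rewrite ?mxE.
rewrite eqM !tr_block_mx !mulmx_block.
rewrite !(trmx0, trmx1, mul0mx, mulmx0, mul1mx, mulmx1, addr0, add0r).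
by rewrite eqC addrC.
Qed.

(** The first row of [T] is determined by the first row of [T^T T]: the corner
    entry is a positive number of known square, and it can be divided out of
    the rest of the row. *)
Lemma cholesky_inj {R : realFieldType} n (T T' : 'M[R]_n) :
  upper_triangular (> 0) predT T -> upper_triangular (> 0) predT T' ->
  T^T *m T = T'^T *m T' -> T = T'.
Proof.
elim: n => [|n IH] in T T' *; first by move=> *; apply/matrixP => -[].
move: T T'; rewrite -[n.+1]/(1 + n)%N => T T'.
move=> /upper_triangular_blockP[a [u [B [-> a_gt0 _ TB]]]].
move=> /upper_triangular_blockP[a' [u' [B' [-> a'_gt0 _ TB']]]].
rewrite !tr_block_mx !mulmx_block !(trmx0, mul0mx, mulmx0, addr0, add0r).
rewrite [a]mx11_scalar [a']mx11_scalar !tr_scalar_mx !mul_scalar_mx.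
move=> /eq_block_mx[eqa equ _ eqB].
have eqaa : a 0 0 = a' 0 0.
  move/matrixP/(_ 0 0): eqa; rewrite !mxE !mulr1n -!expr2 => /eqP.
  by rewrite eqrXn2 ?ltW // => /eqP.
move: equ; rewrite eqaa => /(scalerI (lt0r_neq0 a'_gt0)) eq_u.
by move: eqB; rewrite eq_u => /addrI/(IH _ _ TB TB') ->.
Qed.

Lemma upper_triangular_unitmx {R : realFieldType} n (T : 'M[R]_n) :
  upper_triangular (> 0) predT T -> T \in unitmx.
Proof.
move=> TT; rewrite unitmxE (det_upper_triangular TT) unitfE gt_eqF //.
by apply: prodr_gt0 => i _; exact: upper_triangular_diag TT i.
Qed.

Lemma QR_exists {R : rcfType} n (A : 'M[R]_n) : A \in unitmx ->
  exists K T : 'M[R]_n,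
    [/\ K^T *m K = 1%:M, upper_triangular (> 0) predT T & A = K *m T].
Proof.
move=> Au; have [||T TT eqT] := cholesky n (A^T *m A).
- by rewrite trmx_mul trmxK.
- move=> v v0; rewrite mulmxA -trmx_mul -mulmxA mxE.
  have Av0 : A *m v != 0.
    by apply: contra_neq v0 => Av; rewrite -[v](mulKmx Au) Av mulmx0.
  rewrite lt_def sumr_ge0 ?andbT => [|i _]; last by rewrite mxE -expr2 sqr_ge0.
  apply: contra_neq Av0 => /eqP; rewrite psumr_eq0 => [/allP H|i _]; last first.
    by rewrite mxE -expr2 sqr_ge0.
  apply/colP => i; have := H i (mem_index_enum i).
  by rewrite mxE mulf_eq0 orbb => /eqP ->; rewrite mxE.
have Tu := upper_triangular_unitmx _ _ TT.
exists (A *m invmx T), T; split=> //; last by rewrite mulmxKV.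
rewrite trmx_mul mulmxA -(mulmxA _ A^T) -eqT mulmxA mulmxK //.
by rewrite -trmx_mul mulmxV // trmx1.
Qed.

Lemma QR_upper_inj {R : realFieldType} n (K K' T T' : 'M[R]_n) :
  K^T *m K = 1%:M -> K'^T *m K' = 1%:M ->
  upper_triangular (> 0) predT T -> upper_triangular (> 0) predT T' ->
  K *m T = K' *m T' -> T = T'.
Proof.
move=> KK KK' TT TT' eqKT; apply: cholesky_inj => //.
have E (Q U : 'M[R]_n) : Q^T *m Q = 1%:M -> U^T *m U = (Q *m U)^T *m (Q *m U).
  by move=> QQ; rewrite trmx_mul mulmxA -(mulmxA _ Q^T) QQ mulmx1.
by rewrite (E K) // (E K') // eqKT.
Qed.

(** * Binary normalization of positive numbers *)

Lemma binary_scale {R : archiRealFieldType} (x : R) : 0 < x ->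
  exists (e : int) (s : R), 1 <= s < 2 /\ x = s * 2 ^ e.
Proof.
have ge1 n (y : R) : 1 <= y < 2 ^+ n ->
    exists (e : int) (s : R), 1 <= s < 2 /\ y = s * 2 ^ e.
  elim: n => [|n IH] in y *; first by rewrite expr0; lra.
  move=> /andP[y1 yn]; have [y2|y2] := ltP y 2.
    by exists 0, y; rewrite y1 y2 expr0z mulr1.
  have [|e [s [s12 eqy]]] := IH (y / 2).
    by rewrite ltr_pdivrMr // -exprSr yn andbT; lra.
  exists (e + 1), s; split=> //.
  by rewrite expfzDr ?pnatr_eq0 // expr1z mulrA -eqy; field.
(* [k] is large enough that [x * 2 ^+ k] is at least 1. *)
move=> x0; pose k := Num.bound x^-1; pose m := Num.bound (x * 2 ^+ k).
have xk : 1 <= x * 2 ^+ k.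
  by rewrite -ler_pdivrMl // mulr1 ltW // upper_nthrootP.
have [|e [s [s12 eqx]]] := ge1 m (x * 2 ^+ k).
  by rewrite xk upper_nthrootP.
exists (e - k%:Z), s; split=> //.
rewrite expfzDr ?pnatr_eq0 // mulrA -eqx -exprnN mulfK //.
by rewrite expf_neq0 ?pnatr_eq0.
Qed.

(** If one exponent exceeded the other, the powers of 2 would differ by a factor
    of at least 2, which two mantissas in [1, 2) cannot compensate. *)
Lemma binary_scale_inj {R : realFieldType} (s s' : R) (e e' : int) :
  1 <= s < 2 -> 1 <= s' < 2 -> s * 2 ^ e = s' * 2 ^ e' -> s = s' /\ e = e'.
Proof.
have le (t t' : R) (f f' : int) :
    1 <= t < 2 -> 1 <= t' < 2 -> t * 2 ^ f = t' * 2 ^ f' -> f <= f'.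
  move=> t12 t12' eqt; rewrite leNgt; apply/negP => ltf.
  have le2 : (2 : R) ^ (f' + 1) <= 2 ^ f by rewrite ler_weXz2l ?lezD1 // ler1n.
  have := exprz_gt0 f' (ltr0n R 2); move: le2 eqt.
  rewrite expfzDr ?pnatr_eq0 // expr1z; set a := 2 ^ f; set b := 2 ^ f'; nra.
move=> s12 s12' eqs; have eqe : e = e'.
  by apply/le_anti; rewrite (le s s') // (le s' s).
split=> //; move: eqs; rewrite eqe; apply: mulIf.
by rewrite expfz_neq0 ?pnatr_eq0.
Qed.

(** The intermediate value theorem for ['X^n.+1 - x] between 0 and [1 + x]. *)
Lemma nth_root_exists {R : rcfType} n (x : R) : 0 < x ->
  exists2 r : R, 0 < r & r ^+ n.+1 = x.
Proof.
move=> x0; have [||r /andP[r0 _]] := @poly_ivt R ('X ^+ n.+1 - x%:P) 0 (1 + x).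
- by lra.
- rewrite !hornerE expr0n /=; apply/andP; split; first lra.
  rewrite subr_ge0; apply: (@le_trans _ _ (1 + x)); first lra.
  by rewrite exprS ler_peMr ?exprn_ege1 //; lra.
rewrite rootE !hornerE subr_eq0 => /eqP rx; exists r => //.
rewrite lt_def r0 andbT; apply: contraTneq x0 => r00.
by rewrite -rx r00 expr0n ltxx.
Qed.

(** * Factorization of the products of elements of F and P *)

Lemma mulmx_upper_unitriangular {R : nzRingType} n (A B : 'M[R]_n) :
  upper_triangular (pred1 1) predT A -> upper_triangular (pred1 1) predT B ->
  upper_triangular (pred1 1) predT (A *m B).
Proof.
elim: n => [|n IH] in A B *; first by move=> _ _ [].
move: A B; rewrite -[n.+1]/(1 + n)%N => A B.
move=> /upper_triangular_blockP[a [u [A' [-> /eqP a1 _ TA]]]].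
move=> /upper_triangular_blockP[b [v [B' [-> /eqP b1 _ TB]]]].
rewrite mulmx_block !(mul0mx, mulmx0, addr0, add0r).
apply: upper_triangular_block; [|by []|exact: IH].
by rewrite /= [a]mx11_scalar [b]mx11_scalar a1 b1 mul1mx mxE.
Qed.

Definition unitriangular {R : nzRingType} {n} (y : 'I_n -> 'I_n -> R) :
    'M[R]_n :=
  \matrix_(i, j) if i == j then 1 else if (i < j)%N then y i j else 0.

Lemma unitriangular_upper {R : nzRingType} (P : pred R) n
    (y : 'I_n -> 'I_n -> R) :
  (forall i j : 'I_n, (i < j)%N -> P (y i j)) ->
  upper_triangular (pred1 1) P (unitriangular y).
Proof.
move=> Py i j; rewrite mxE -val_eqE.
by case: ltngtP => [_|/Py|_] //=.
Qed.

Lemma upper_unitriangularE {R : nzRingType} (P : pred R) n (A : 'M[R]_n) :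
  upper_triangular (pred1 1) P A ->
  (forall i j : 'I_n, (i < j)%N -> P (A i j)) /\ A = unitriangular A.
Proof.
move=> TA; split=> [i j|]; last apply/matrixP => i j; move: (TA i j).
  by rewrite -val_eqE; case: ltngtP.
by rewrite mxE -val_eqE; case: ltngtP => //= _ /eqP.
Qed.

Definition diag_sandwich {R : comNzRingType} {n} (r : R) (w v : 'I_n -> R)
    (U : 'M[R]_n) :=
  r *: (diag_mx (\row_i w i) *m U *m diag_mx (\row_i v i)).

Lemma diag_sandwichE {R : comNzRingType} {n} (r : R) w v (U : 'M[R]_n) i j :
  diag_sandwich r w v U i j = r * (w i * U i j * v j).
Proof. by rewrite mxE mul_mx_diag mxE mul_diag_mx !mxE. Qed.

Lemma FP_productE {R : realType} n (s : R) k w y (l : int) kappa mu :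
  s *: (k *m zmatrix w y) *m (2 ^ l *: qmatrix R kappa mu) =
  k *m diag_sandwich (s * 2 ^ l) w (fun i => 2 ^ kappa i)
         (unitriangular y *m unitriangular (fun i j => (mu i j)%:~R)) :> 'M_n.
Proof.
have -> : zmatrix w y = diag_mx (\row_i w i) *m unitriangular y.
  apply/matrixP => i j; rewrite mul_diag_mx !mxE.
  by case: ifP => _; rewrite ?mulr1 //; case: ifP; rewrite ?mulr0.
have -> : qmatrix R kappa mu = unitriangular (fun i j => (mu i j)%:~R) *m
                               diag_mx (\row_i 2 ^ kappa i).
  apply/matrixP => i j; rewrite mul_mx_diag !mxE.
  case: eqP => [->|_]; first by rewrite mul1r.
  by case: ifP => _; rewrite ?mul0r // mulrC.
by rewrite /diag_sandwich -scalemxAl -!scalemxAr scalerA !mulmxA.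
Qed.

Lemma diag_sandwich_upper {R : realFieldType} n (r : R) w v (U : 'M[R]_n) :
  0 < r -> (forall i, 0 < w i) -> (forall i, 0 < v i) ->
  upper_triangular (pred1 1) predT U ->
  upper_triangular (> 0) predT (diag_sandwich r w v U).
Proof.
move=> r0 w0 v0 TU i j; rewrite diag_sandwichE; have := TU i j.
case: ifP => _; first by move=> ->; rewrite mulr0 mul0r mulr0.
case: ifP => // _ /eqP ->; rewrite mulr1.
exact: mulr_gt0 r0 (mulr_gt0 (w0 i) (v0 j)).
Qed.

Lemma diag_sandwich_solve {R : realFieldType} n (r : R) w v (T : 'M[R]_n) :
  r != 0 -> (forall i, w i != 0) -> (forall i, v i != 0) ->
  upper_triangular (> 0) predT T -> (forall i, T i i = r * (w i * v i)) ->
  exists2 U, upper_triangular (pred1 1) predT U & T = diag_sandwich r w v U.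
Proof.
move=> r0 w0 v0 TT dT; exists (\matrix_(i, j) (T i j / (r * (w i * v j)))).
  move=> i j; rewrite !mxE; have := TT i j.
  case: ifP => _; first by move=> ->; rewrite mul0r.
  case: eqP => // <- _; rewrite dT /= divff ?mulf_neq0 //.
by apply/matrixP => i j; rewrite diag_sandwichE mxE; field; rewrite r0 w0 v0.
Qed.

Lemma diag_sandwich_inj {R : realFieldType} n (r : R) w v (U U' : 'M[R]_n) :
  r != 0 -> (forall i, w i != 0) -> (forall i, v i != 0) ->
  diag_sandwich r w v U = diag_sandwich r w v U' -> U = U'.
Proof.
move=> r0 w0 v0 /matrixP eqU; apply/matrixP => i j.
have := eqU i j; rewrite !diag_sandwichE.
by move=> /(mulfI r0)/(mulIf (v0 j))/(mulfI (w0 i)).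
Qed.

(** * Diagonals of determinant one *)

(** The conditions that define [w] and (after exponentiation) [kappa] at the
    last index are the statement that the whole product is 1; in this form they
    can be used without singling out the last index, and without excluding
    [n = 0]. *)
Lemma last_factor {R : fieldType} n (f : 'I_n -> R) : (forall i, f i != 0) ->
  (forall i : 'I_n, i.+1 = n -> f i = \prod_(j < n | (j < n.-1)%N) (f j)^-1) <->
  \prod_i f i = 1.
Proof.
case: n f => [|n] f f0; first by split=> [_|_ []]; first exact: big_ord0.
have predE (j : 'I_n.+1) : (j < n)%N = (j != ord_max).
  by rewrite -val_eqE ltn_neqAle leq_ord andbT.
rewrite [X in _ <-> X = _](bigD1 ord_max) //= prodfV (eq_bigl _ _ predE).
set p := \prod_(_ | _) _; have p0 : p != 0 by apply/prodf_neq0 => j _.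
split=> [->|fp i [/= i_n]]; rewrite ?mulVf //.
have -> : i = ord_max by exact: val_inj.
by rewrite -[LHS](mulfK p0) fp mul1r.
Qed.

Lemma exp2_sum {R : numFieldType} (I : finType) (P : pred I) (k : I -> int) :
  (2 : R) ^ (\sum_(i | P i) k i) = \prod_(i | P i) 2 ^ k i.
Proof.
by apply: big_morph => // x y; rewrite expfzDr ?pnatr_eq0.
Qed.

Definition normalized_mantissas {R : realFieldType} n (w : 'I_n -> R) :=
  (forall i : 'I_n, (i < n.-1)%N -> 1 <= w i < 2) /\
  (forall i : 'I_n, i.+1 = n -> w i = \prod_(j < n | (j < n.-1)%N) (w j)^-1).

Definition normalized_exponents n (k : 'I_n -> int) :=
  forall i : 'I_n, i.+1 = n -> k i = - \sum_(j < n | (j < n.-1)%N) k j.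

Lemma ord_lastP n (i : 'I_n) : (i < n.-1)%N \/ i.+1 = n.
Proof.
by case: n i => [[]//|n i]; case: (ltngtP i n); have := leq_ord i; lia.
Qed.

Lemma normalized_mantissas_gt0 {R : realFieldType} n (w : 'I_n -> R) :
  normalized_mantissas n w -> forall i, 0 < w i.
Proof.
move=> [w12 wl] i.
have pos (j : 'I_n) : (j < n.-1)%N -> 0 < w j by move/w12; lra.
have [/pos //|/wl ->] := ord_lastP n i.
by apply: prodr_gt0 => j /pos; rewrite invr_gt0.
Qed.

Lemma prod_normalized {R : realFieldType} n (w : 'I_n -> R) k :
  normalized_mantissas n w -> normalized_exponents n k ->
  \prod_i (w i * 2 ^ k i) = 1.
Proof.
move=> nw nk; have w0 := normalized_mantissas_gt0 _ _ nw.
apply/last_factor => [i|i il].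
  by rewrite mulf_neq0 ?expfz_neq0 ?pnatr_eq0 // gt_eqF.
rewrite (proj2 nw) // nk // -sumrN exp2_sum -big_split /=.
by apply: eq_bigr => j _; rewrite invfM invr_expz.
Qed.

(** At the indices before the last one, [w] and [k] are the binary mantissa and
    exponent of [e i].  At the last index they are forced by normalization, and
    [e i = w i * 2 ^ k i] holds there because both sides are the inverse of the
    product of the other factors. *)
Lemma normalized_exists {R : archiRealFieldType} n (e : 'I_n -> R) :
  (forall i, 0 < e i) -> \prod_i e i = 1 ->
  exists w k, [/\ normalized_mantissas n w, normalized_exponents n k &
                  forall i, e i = w i * 2 ^ k i].
Proof.
move=> e0 e1.
have sc i : exists ks : int * R, 1 <= ks.2 < 2 /\ e i = ks.2 * 2 ^ ks.1.
  by have [k [s ?]] := binary_scale (e i) (e0 i); exists (k, s).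
have [g gE] := choice sc.
have sel (V : Type) (f : 'I_n -> V) c : exists h : 'I_n -> V,
    (forall i : 'I_n, (i < n.-1)%N -> h i = f i) /\
    (forall i : 'I_n, i.+1 = n -> h i = c).
  exists (fun i : 'I_n => if (i < n.-1)%N then f i else c).
  by split=> i; [move=> -> | move=> il; rewrite ifN //; lia].
have [w [wE wl]] := sel _ (fun i => (g i).2)
  (\prod_(j < n | (j < n.-1)%N) (g j).2^-1).
have [k [kE kl]] := sel _ (fun i => (g i).1)
  (- \sum_(j < n | (j < n.-1)%N) (g j).1).
have nw : normalized_mantissas n w.
  split=> i il; first by rewrite wE //; have [] := gE i.
  by rewrite wl //; apply: eq_bigr => j /wE ->.
have nk : normalized_exponents n k.
  by move=> i il; rewrite kl //; congr (- _); apply: eq_bigr => j /kE ->.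
have ewk (i : 'I_n) : (i < n.-1)%N -> e i = w i * 2 ^ k i.
  by move=> il; rewrite wE // kE //; have [] := gE i.
exists w, k; split=> // i; have [/ewk //|il] := ord_lastP n i.
have w0 := normalized_mantissas_gt0 _ _ nw.
have -> := proj2 (last_factor n e (fun j => lt0r_neq0 (e0 j))) e1 i il.
have f0 j : w j * 2 ^ k j != 0.
  by rewrite mulf_neq0 ?expfz_neq0 ?pnatr_eq0 // gt_eqF.
have -> := proj2 (last_factor n _ f0) (prod_normalized _ _ _ nw nk) i il.
by apply: eq_bigr => j /ewk ->.
Qed.

(** The products of both diagonals give [r ^+ n = r' ^+ n]; this is where
    [n > 0] matters. *)
Lemma normalized_inj {R : realFieldType} n (r r' : R) (w w' : 'I_n -> R) k k' :
  (0 < n)%N -> 0 < r -> 0 < r' ->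
  normalized_mantissas n w -> normalized_exponents n k ->
  normalized_mantissas n w' -> normalized_exponents n k' ->
  (forall i, r * (w i * 2 ^ k i) = r' * (w' i * 2 ^ k' i)) ->
  [/\ r = r', w =1 w' & k =1 k'].
Proof.
move=> n0 r0 r0' nw nk nw' nk' eqd.
have eqr : r = r'.
  have prodE t u h : normalized_mantissas n u -> normalized_exponents n h ->
      \prod_i (t * (u i * 2 ^ h i)) = t ^+ n :> R.
    move=> nu nh; rewrite big_split /= prod_normalized // mulr1.
    by rewrite prodr_const card_ord.
  have /eqP : r ^+ n = r' ^+ n.
    by rewrite -(prodE r w k) // -(prodE r' w' k') //; apply: eq_bigr.
  by rewrite eqrXn2 ?ltW // => /eqP.
have eqi (i : 'I_n) : (i < n.-1)%N -> w i = w' i /\ k i = k' i.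
  move=> il; apply: binary_scale_inj; [exact: (proj1 nw) | exact: (proj1 nw')|].
  by apply: (mulfI (lt0r_neq0 r0)); rewrite eqd eqr.
split=> // i; have [/eqi[] //|il] := ord_lastP n i.
  by rewrite (proj2 nw) // (proj2 nw') //; apply: eq_bigr => j /eqi[->].
by rewrite nk // nk' //; congr (- _); apply: eq_bigr => j /eqi[_ ->].
Qed.

(** * Unique factorization *)

Theorem proposition4p2 (R : realType) (n : nat) :
  (forall p q : 'M[R]_n, Pset R n p -> Pset R n q -> p <> q ->
     right_translate (Fset R n) p `&` right_translate (Fset R n) q = set0) /\
  \bigcup_(p in Pset R n) right_translate (Fset R n) p = GLset R n.
Proof.
have exp2_gt0 (e : int) : (0 : R) < 2 ^ e by rewrite exprz_gt0.
have upperYN (y : 'I_n -> 'I_n -> R) (m : 'I_n -> 'I_n -> int) :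
    upper_triangular (pred1 1) predT
      (unitriangular y *m unitriangular (fun i j => (m i j)%:~R)).
  by apply: mulmx_upper_unitriangular; apply: unitriangular_upper.
split.
  move=> p q [l [k [m [nk ->]]]] [l' [k' [m' [nk' ->]]]] neq.
  rewrite -subset0 => A [[_ [s [K [w [y [s12 OK [w12 wl y01] ->]]]]] <-]].
  move=> [_ [s' [K' [w' [y' [s12' OK' [w12' wl' y01'] ->]]]]]].
  rewrite !FP_productE => /esym eqA; apply: neq.
  (* For [n = 0] the scalars [s] and [2 ^ l] are not determined, but all the
     matrices are equal. *)
  have [n0|n0] := posnP n.
    by apply/matrixP => i; have := ltn_ord i; rewrite {2}n0.
  have nw : normalized_mantissas n w by [].
  have nw' : normalized_mantissas n w' by [].
  have w0 := normalized_mantissas_gt0 _ _ nw.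
  have w0' := normalized_mantissas_gt0 _ _ nw'.
  have r0 : 0 < s * 2 ^ l by rewrite mulr_gt0 //; lra.
  have r0' : 0 < s' * 2 ^ l' by rewrite mulr_gt0 //; lra.
  have eqT := QR_upper_inj _ _ _ _ _ OK OK'
    (diag_sandwich_upper _ _ _ _ _ r0 w0
       (fun i => exp2_gt0 (k i)) (upperYN y m))
    (diag_sandwich_upper _ _ _ _ _ r0' w0'
       (fun i => exp2_gt0 (k' i)) (upperYN y' m')) eqA.
  have eqd i : s * 2 ^ l * (w i * 2 ^ k i) = s' * 2 ^ l' * (w' i * 2 ^ k' i).
    move/matrixP/(_ i i): eqT; rewrite !diag_sandwichE.
    by rewrite !(eqP (upper_triangular_diag (upperYN _ _) i)) !mulr1.
  have [eqr eqw eqk] :=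
    normalized_inj _ _ _ _ _ _ _ n0 r0 r0' nw nk nw' nk' eqd.
  have [_ eql] := binary_scale_inj _ _ _ _ s12 s12' eqr.
  have eqYN : unitriangular y *m unitriangular (fun i j => (m i j)%:~R) =
              unitriangular y' *m unitriangular (fun i j => (m' i j)%:~R).
    apply: (diag_sandwich_inj _ (s * 2 ^ l) w (fun i => 2 ^ k i)).
    - by rewrite gt_eqF.
    - by move=> i; rewrite gt_eqF.
    - by move=> i; rewrite gt_eqF.
    rewrite eqT -eqr /diag_sandwich; congr (_ *: (_ *m _)).
      by congr (_ *m _); congr diag_mx; apply/rowP => i; rewrite !mxE eqw.
    by congr diag_mx; apply/rowP => i; rewrite !mxE eqk.
  have /matrixP eqN := unitriangular_factor_inj _ _ _ _ _
    (unitriangular_upper _ _ _ y01) (unitriangular_upper _ _ _ y01')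
    (unitriangular_upper _ _ _ (fun i j _ => intr_int R (m i j)))
    (unitriangular_upper _ _ _ (fun i j _ => intr_int R (m' i j))) eqYN.
  rewrite eql; congr (_ *: _); apply/matrixP => i j; rewrite !mxE !eqk.
  case: eqP => // _; case: ifP => // lij; move: (eqN i j).
  by rewrite !mxE lij -val_eqE ltn_eqF //= => ->.
apply/seteqP; split=> A.
  move=> [p [l [k [m [nk ->]]]]].
  move=> [_ [s [K [w [y [s12 OK [w12 wl y01] ->]]]]] <-].
  rewrite FP_productE; rewrite /GLset /= unitmx_mul.
  have w0 : forall i, 0 < w i by apply: normalized_mantissas_gt0.
  rewrite (proj2 (mulmx1_unit OK)) upper_triangular_unitmx //.
  by apply: diag_sandwich_upper => //; rewrite mulr_gt0 //; lra.
move=> /QR_exists[K [T [OK TT ->]]].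
have T0 := upper_triangular_diag TT.
have [r r0 rn] : exists2 r : R, 0 < r & r ^+ n = \prod_i T i i.
  (* For [n = 0] the empty product is 1, and any [r] would do. *)
  have [n0|n0] := posnP n.
    exists 1; rewrite // expr1n big1 // => i _.
    by have := ltn_ord i; rewrite {2}n0.
  have prodT : 0 < \prod_i T i i by apply: prodr_gt0 => i _; exact: T0.
  by have := nth_root_exists n.-1 _ prodT; rewrite prednK.
have [||w [k [nw nk wk]]] := normalized_exists n (fun i => T i i / r).
- by move=> i; rewrite divr_gt0 // T0.
- rewrite big_split /= prodr_const card_ord -rn exprVn mulfV //.
  by rewrite expf_neq0 // gt_eqF.
have [l [s [s12 eqr]]] := binary_scale r r0.
have w0 := normalized_mantissas_gt0 _ _ nw.
have [|||||U TU eqT] := diag_sandwich_solve n r w (fun i => 2 ^ k i) T.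
- by rewrite gt_eqF.
- by move=> i; rewrite gt_eqF.
- by move=> i; rewrite gt_eqF.
- by [].
- by move=> i; rewrite -wk mulrC divfK // gt_eqF.
have [Y [N [TY TN eqU]]] := unitriangular_factor n U TU.
move: TY TN eqU => /upper_unitriangularE[y01 ->].
move=> /upper_unitriangularE[mint ->] eqU.
pose m i j := Num.floor (N i j).
exists (2 ^ l *: qmatrix R k m); first by exists l, k, m.
exists (s *: (K *m zmatrix w Y)).
  by exists s, K, w, Y; case: nw.
rewrite FP_productE -eqr eqT eqU; congr (_ *m diag_sandwich _ _ _ (_ *m _)).
apply/matrixP => i j; rewrite !mxE; case: eqP => // _; case: ifP => // lij.
by rewrite floorK //; exact: mint.
Qed.
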